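(* Let $p>1$ and let $u_0\ge0$ be a compactly supported finite Borel measure on $\mathbb{R}$ with total mass $\|u_0\|_{\mathcal M}$. There is a constant $C>0$, independent of $\varepsilon>0$, such that for every $\varepsilon>0$ the solution $u(x,t)$ of $$u_t+(u^p)_x=\varepsilon u_{xx},\quad x\in\mathbb{R},\ t>0,\qquad u(\cdot,0)=u_0,$$ satisfies: (1) $\|u(\cdot,t)\|_{L^\infty(\mathbb{R})}\le C\,\|u_0\|_{\mathcal M}^{1/p}\,t^{-1/p}$ for all $t>0$; (2) $\|u(\cdot,t)\|_{L^2(\mathbb{R})}\le C\,\|u_0\|_{\mathcal M}^{\frac{p+1}{2p}}\,t^{-\frac{1}{2p}}$ for all $t>0$.
   Context: **Classical solution.** A continuous function on $\mathbb{R}\times(0,\infty)$ whose derivatives $u_t,u_x,u_{xx}$ are continuous and which satisfies the equation pointwise. **The solution with measure initial data.** The solution $u$ meant here is the nonnegative classical solution obtained as follows. Let $u_0^{(k)}\in C_0^\infty(\mathbb{R})$ be nonnegative mollifications of $u_0$, supported in a common compact interval, with $\|u_0^{(k)}\|_{L^1}\le\|u_0\|_{\mathcal M}$ and $u_0^{(k)}\to u_0$ in the sense of measures. Let $u^{(k)}$ be the (unique, nonnegative, global) classical solution of the equation with $u^{(k)}(\cdot,0)=u_0^{(k)}$. Then $u$ is the limit of a subsequence of $u^{(k)}$, the convergence being uniform, together with the derivatives appearing in the equation, on compact subsets of $\mathbb{R}\times(0,\infty)$. It satisfies $u(\cdot,t)\to u_0$ in the sense of measures as $t\to0+$ and $\int_{\mathbb{R}}u(x,t)\,dx=\|u_0\|_{\mathcal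 M}$ for all $t>0$. *)

(* Defs.v *)
From mathcomp Require Export all_boot all_order all_algebra.
From mathcomp Require Export all_classical all_reals all_analysis.

Set Implicit Arguments.
Unset Strict Implicit.
Unset Printing Implicit Defensive.

Import Order.TTheory GRing.Theory Num.Theory.
Import numFieldNormedType.Exports.

Local Open Scope ring_scope.
Local Open Scope classical_set_scope.

Section definitions.
Context {R : realType}.

Local Notation leb := (@lebesgue_measure R).

(* Space-time functions are written [u x t]; they are total functions on R^2
   but only their values on the half-plane where the equation (and, for regular
   data, the initial condition) lives are ever constrained. *)
Definition pt (u : R -> R -> R) : R -> R -> R :=
  fun x t => (fun s => u x s)^`() t.
Definition px (u : R -> R -> R) : R -> R -> R :=
  fun x t => (fun y => u y t)^`() x.

Definition open_halfplane : set (R * R) := [set z | 0 < z.2].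
Definition closed_halfplane : set (R * R) := [set z | 0 <= z.2].

Definition continuous_on (D : set (R * R)) (u : R -> R -> R) :=
  {within D, continuous (fun z : R * R => u z.1 z.2)}.

(* [powR] takes the value 1 on negative reals, so [u x t `^ p] is the intended
   power only for [u >= 0]; every use below comes with that sign condition. *)
Record classical_solution (p eps : R) (u : R -> R -> R) : Prop := {
  cs_continuous : continuous_on open_halfplane u;
  cs_derivable_t : forall x t : R, 0 < t -> derivable (fun s => u x s) t 1;
  cs_derivable_x : forall x t : R, 0 < t -> derivable (fun y => u y t) x 1;
  cs_derivable_xx : forall x t : R, 0 < t -> derivable (fun y => px u y t) x 1;
  cs_continuous_t : continuous_on open_halfplane (pt u);
  cs_continuous_x : continuous_on open_halfplane (px u);
  cs_continuous_xx : continuous_on open_halfplane (px (px u));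
  cs_equation : forall x t : R, 0 < t ->
    pt u x t + px (fun y s => u y s `^ p) x t = eps * px (px u) x t
}.

Definition smooth (f : R -> R) := forall (n : nat) (x : R), derivable (f^`(n)) x 1.

Definition supported_in (M : R) (f : R -> R) := forall x : R, M < `|x| -> f x = 0.

Definition compactly_supported_measure
    (mu : set (measurableTypeR R) -> \bar R) :=
  exists M : R, mu (~` `[- M, M]) = 0%E.

(* Convergence in the sense of measures of the densities [f k] with respect to
   Lebesgue measure, i.e. against continuous compactly supported functions. *)
Definition cvg_measure {I : Type} (F : set_system I) (f : I -> R -> R)
    (mu : {measure set (measurableTypeR R) -> \bar R}) :=
  forall (phi : R -> R) (M : R), continuous phi -> supported_in M phi ->
    \int[leb]_x (phi x * f k x) @[k --> F] --> \int[mu]_x phi x.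

Record regularized_data (mu : {measure set (measurableTypeR R) -> \bar R})
    (f : nat -> R -> R) : Prop := {
  rd_smooth : forall k, smooth (f k);
  rd_ge0 : forall k x, 0 <= f k x;
  rd_support : exists M : R, forall k, supported_in M (f k);
  rd_mass : forall k, ('N[leb]_1[EFin \o f k] <= mu setT)%E;
  rd_cvg : cvg_measure \oo f mu
}.

(* Boundedness on the strips R x [0, T] is the class in which the Cauchy problem
   with bounded data is uniquely solvable, so this singles out
   "the" global solution with initial datum [f]. *)
Record cauchy_solution (p eps : R) (f : R -> R) (u : R -> R -> R) : Prop := {
  ca_classical : classical_solution p eps u;
  ca_ge0 : forall x t : R, 0 <= t -> 0 <= u x t;
  ca_continuous : continuous_on closed_halfplane u;
  ca_bounded : forall T : R, exists M : R, forall x t : R, 0 <= t <= T -> u x t <= M;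
  ca_initial : forall x, u x 0 = f x
}.

Definition cvg_locally_uniformly (v : nat -> R -> R -> R) (u : R -> R -> R) :=
  forall K : set (R * R), compact K -> K `<=` open_halfplane ->
    {uniform K, (fun k (z : R * R) => v k z.1 z.2) @ \oo -->
                (fun z : R * R => u z.1 z.2)}.

Record measure_data_solution (p eps : R)
    (mu : {measure set (measurableTypeR R) -> \bar R}) (u : R -> R -> R)
    : Prop := {
  ms_classical : classical_solution p eps u;
  ms_ge0 : forall x t : R, 0 < t -> 0 <= u x t;
  ms_limit : exists (f : nat -> R -> R) (v : nat -> R -> R -> R)
                    (s : nat -> nat),
    [/\ regularized_data mu f,
        forall k, cauchy_solution p eps (f k) (v k),
        {homo s : m n / (m < n)%N} &
        [/\ cvg_locally_uniformly (fun k => v (s k)) u,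
            cvg_locally_uniformly (fun k => pt (v (s k))) (pt u),
            cvg_locally_uniformly (fun k => px (v (s k))) (px u) &
            cvg_locally_uniformly (fun k => px (px (v (s k)))) (px (px u))]];
  ms_initial : cvg_measure 0^'+ (fun t x => u x t) mu;
  ms_mass : forall t : R, 0 < t -> (\int[leb]_x (u x t)%:E = mu setT)%E
}.

End definitions.

(* Main.v *)
Require Import Defs.
From mathcomp Require Import all_boot all_order all_algebra.
From mathcomp Require Import all_classical all_reals all_analysis.
From mathcomp Require Import measurable_realfun ess_sup_inf ring lra.

Set Implicit Arguments.
Unset Strict Implicit.
Unset Printing Implicit Defensive.

Import Order.TTheory GRing.Theory Num.Theory.
Import numFieldNormedType.Exports.

Local Open Scope ring_scope.
Local Open Scope classical_set_scope.

(* The approximating solution [v] has a potential [U] with [U_x = v] and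
   [U_t = eps v_x - v^p], a viscous Hamilton-Jacobi equation whose maximum
   principle confines [U] to an interval whose length [m] is the initial mass.
   Normalise [0 <= U <= m].  Since
   [U_t + p v^(p-1) U_x - eps U_xx = (p - 1) v^p], the function [g(t) (m + U)]
   with [g' = - (p - 1) m^(p-1) g^(p+1)] is a supersolution of the equation
   solved by [v] wherever it lies below [v], so [v <= 2 m g(t)] uniformly in
   [eps].
   This is Bernstein's gradient estimate for [U], and it involves only the
   derivatives [v_t], [v_x], [v_xx] that a classical solution has.  The
   estimate passes to the pointwise limit, and the L^2 bound follows by
   interpolation with the mass. *)

(** * Mean value estimates and derivative tests at a maximum *)

Section one_variable.
Context {R : realType}.
Implicit Types f g df : R -> R.

Lemma is_derive_gt0_local f (x d : R) : is_derive x 1 f d -> 0 < d ->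
  exists2 e, 0 < e & forall y, `|y - x| < e ->
    (x < y -> f x < f y) /\ (y < x -> f y < f x).
Proof.
move=> [df dE] d0.
have dl : h^-1 *: (f (h *: 1 + x) - f x) @[h --> 0^'] --> d.
  by rewrite -dE; exact: df.
have : \forall h \near (0:R)^', 0 < h^-1 *: (f (h *: 1 + x) - f x).
  by apply: (cvgr_gt d dl 0).
rewrite near_withinE => /nbhs_ballP [e /= e0 he].
exists e => // y yxe.
have := he (y - x); rewrite /ball/= sub0r normrN => /(_ yxe).
rewrite subr_eq0 scaler1 subrK => H; split => xy.
- have /H : y != x by rewrite gt_eqF.
  by rewrite pmulr_rgt0 ?invr_gt0 ?subr_gt0.
- have /H : y != x by rewrite lt_eqF.
  by rewrite nmulr_rgt0 ?invr_lt0 ?subr_lt0.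
Qed.

Lemma is_derive_continuous f (x d : R) : is_derive x 1 f d -> {for x, continuous f}.
Proof.
by move=> [df _]; apply/differentiable_continuous/derivable1_diffP.
Qed.

Lemma mean_value f df (a b : R) : a < b ->
  (forall x, a <= x <= b -> is_derive x 1 f (df x)) ->
  exists2 c, a < c < b & f b - f a = df c * (b - a).
Proof.
move=> ab dfx; have [||c] := @MVT R f df a b ab.
- by move=> x; rewrite in_itv/= => /andP[ax xb]; apply: dfx; rewrite !ltW.
- apply: continuous_in_subspaceT => x; rewrite inE/= in_itv/= => axb.
  exact: is_derive_continuous (dfx _ axb).
- by rewrite in_itv/=; exists c.
Qed.

Lemma mean_value_le f df (a b K : R) :
  (forall x, Num.min a b <= x <= Num.max a b -> is_derive x 1 f (df x)) ->
  (forall x, Num.min a b <= x <= Num.max a b -> `|df x| <= K) ->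
  `|f b - f a| <= K * `|b - a|.
Proof.
have key (u v : R) : u < v ->
    (forall x, u <= x <= v -> is_derive x 1 f (df x)) ->
    (forall x, u <= x <= v -> `|df x| <= K) ->
    `|f v - f u| <= K * `|v - u|.
  move=> uv fd fK; have [c /andP[uc cv] ->] := mean_value uv fd.
  by rewrite normrM ler_wpM2r// fK// !ltW.
move=> fd fK; case: (ltgtP a b) fd fK => [ab|ba|->] fd fK.
- exact: key.
- by rewrite distrC (distrC b); exact: key.
- by rewrite !subrr normr0 mulr0.
Qed.

Lemma between_dist_le (a b c : R) :
  Num.min a b <= c <= Num.max a b -> `|c - a| <= `|b - a|.
Proof.
have [ab|/ltW ba] := leP a b => /andP[c1 c2].
  by rewrite !ger0_norm ?subr_ge0// lerD2r.
by rewrite !ler0_norm ?subr_le0// lerN2 lerD2r.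
Qed.

(** A positive second derivative at [x], where [df] vanishes, would make [df] positive just to the
    right of [x], and the mean value theorem would then lift [f] above its maximum. *)
Lemma derive_at_max f df (x d : R) : (forall y : R, is_derive y 1 f (df y)) ->
  is_derive x 1 df d -> (forall y, f y <= f x) -> df x = 0 /\ d <= 0.
Proof.
move=> fd dfd fmax; have df0 : df x = 0.
  have := @derive1_at_max _ f (x - 1) (x + 1) x.
  move=> H; have [] := H; rewrite ?in_itv/=.
  - lra.
  - by move=> y _; have [] := fd y.
  - by apply/andP; split; lra.
  - by move=> y _; exact: fmax.
  - by move=> _ <-; have [_ <-] := fd x.
split => //; rewrite leNgt; apply/negP => d0.
have [e e0 he] := is_derive_gt0_local dfd d0.
have [|c /andP[xc cx]] := @mean_value f df x (x + e) _ (fun y _ => fd y); first lra.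
have [|+ _] := he c; first by rewrite ger0_norm; lra.
move=> /(_ xc); rewrite df0 => dc0.
rewrite addrAC subrr add0r => fE.
have := fmax (x + e); rewrite -subr_le0 fE leNgt.
by rewrite mulr_gt0.
Qed.

(** This is the test in the time variable: at the last instant of a slab only the past is available,
    so the derivative has a sign but need not vanish. *)
Lemma derive_at_left_max f (a t d : R) : is_derive t 1 f d -> a < t ->
  (forall s, a <= s <= t -> f s <= f t) -> 0 <= d.
Proof.
move=> fd at_ fmax; rewrite leNgt; apply/negP => d0.
have nd : is_derive t 1 (- f) (- d) by apply: is_deriveN.
have [|e e0 he] := is_derive_gt0_local nd; first by rewrite oppr_gt0.
pose s := Num.max a (t - e / 2).
have st : s < t by rewrite gt_max at_/=; lra.
have as_ : a <= s by rewrite le_max lexx.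
have es : t - e / 2 <= s by rewrite le_max lexx orbT.
have [|_ /(_ st)] := he s; first by rewrite ltr0_norm; lra.
rewrite ltrN2 ltNge fmax//; apply/andP; split => //; exact: ltW.
Qed.

End one_variable.

(** * Differentiation rules in the pointwise form used below *)

Section derivative_rules.
Context {R : realType}.
Implicit Types f g df : R -> R.

Lemma is_derive_sub f g (x a b : R) : is_derive x 1 f a -> is_derive x 1 g b ->
  is_derive x 1 (fun y => f y - g y) (a - b).
Proof. by move=> fa gb; exact: is_deriveB. Qed.

Lemma is_derive_add f g (x a b : R) : is_derive x 1 f a -> is_derive x 1 g b ->
  is_derive x 1 (fun y => f y + g y) (a + b).
Proof. by move=> fa gb; exact: is_deriveD. Qed.

Lemma is_derive_opp f (x a : R) : is_derive x 1 f a ->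
  is_derive x 1 (fun y => - f y) (- a).
Proof. by move=> fa; exact: is_deriveN. Qed.

Lemma is_derive_mul f g (x a b : R) : is_derive x 1 f a -> is_derive x 1 g b ->
  is_derive x 1 (fun y => f y * g y) (a * g x + f x * b).
Proof.
move=> fa gb; apply: (is_derive_eq (is_deriveM fa gb)).
by rewrite /GRing.scale/= addrC; congr (_ + _); rewrite mulrC.
Qed.

Lemma is_derive_scale f (c x a : R) : is_derive x 1 f a ->
  is_derive x 1 (fun y => c * f y) (c * a).
Proof. by move=> fa; exact: is_deriveZ. Qed.

Lemma is_derive_affine (c d x : R) : is_derive x 1 (fun y => c * y + d) c.
Proof.
have H := is_derive_add (is_derive_scale c (is_derive_id x 1)) (is_derive_cst d x 1).
by apply: (is_derive_eq H); rewrite mulr1 addr0.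
Qed.

Lemma is_derive_comp f g (x a b : R) : is_derive (g x) 1 f a ->
  is_derive x 1 g b -> is_derive x 1 (fun y => f (g y)) (a * b).
Proof.
move=> fa gb; have := @is_derive1_comp _ f g x a b fa gb.
by rewrite mulrC.
Qed.

End derivative_rules.

(** * A maximum principle on a strip for functions of linear growth *)

Section maximum_principle.
Context {R : realType}.
Implicit Types w wt wx wxx : R -> R -> R.

(* The barrier [k e^(K (t - s)) (1 + x^2)] beats the linear growth of [w] at
   infinity, so that a positive part of the difference would attain its
   maximum. *)
Lemma maximum_principle w wt wx wxx (eps b A k s T : R) :
  0 <= eps -> 0 <= b -> 0 < k ->
  {within [set z : R * R | s <= z.2 <= T], continuous (fun z => w z.1 z.2)} ->
  (forall x t, s <= t <= T -> w x t <= A * (1 + `|x|)) ->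
  (forall x, w x s <= k * (1 + x ^+ 2)) ->
  (forall x t : R, s < t <= T -> is_derive t 1 (w x) (wt x t)) ->
  (forall x t : R, s < t <= T -> is_derive x 1 (w^~ t) (wx x t)) ->
  (forall x t : R, s < t <= T -> is_derive x 1 (wx^~ t) (wxx x t)) ->
  (forall x t, s < t <= T -> 0 < w x t ->
     wt x t <= eps * wxx x t + b * `|wx x t|) ->
  forall x t, s <= t <= T ->
    w x t <= k * expR ((2 * eps + b + 1) * (t - s)) * (1 + x ^+ 2).
Proof.
move=> eps0 b0 k0 wc wA ws dt dx dxx wE x0 t0 st0; rewrite leNgt; apply/negP => w0.
set K := 2 * eps + b + 1 in w0 *.
pose e t := expR (K * (t - s)).
have K0 : 0 < K by rewrite /K; lra.
have e0 t : 0 < e t by exact: expR_gt0.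
have e1 t : s <= t -> 1 <= e t.
  move=> st; rewrite /e -expR0 ler_expR.
  by apply: mulr_ge0; [exact: ltW|rewrite subr_ge0].
pose g x t := w x t - k * e t * (1 + x ^+ 2).
have g0 : 0 < g x0 t0 by rewrite subr_gt0.
(* Beyond this radius [1 <= |x|] and [2 |A| <= k |x|], so the linear bound [A (1 + |x|)] stays below
   [k x^2]. The summand [|x0|] puts the bad point inside the box. *)
pose r : R := `|x0| + 1 + 2 * `|A| / k.
have rA : 0 <= 2 * `|A| / k by rewrite divr_ge0 ?mulr_ge0// ltW.
have gr x t : s <= t <= T -> r < `|x| -> g x t <= 0.
  move=> /[dup] /andP[st _] stT rx; rewrite subr_le0.
  apply: (le_trans (wA _ _ stT)).
  have kx : k * (1 + x ^+ 2) <= k * e t * (1 + x ^+ 2).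
    by apply: ler_wpM2r; [have := sqr_ge0 x; lra|rewrite ler_peMr ?e1// ltW].
  apply: le_trans kx; rewrite -(real_normK (num_real x)).
  have x1 : 1 <= `|x| by have := normr_ge0 x0; rewrite /r in rx; lra.
  have Ax : 2 * `|A| <= k * `|x|.
    apply: ltW; rewrite (mulrC k) -ltr_pdivrMr//; apply: le_lt_trans rx.
    by rewrite /r; have := normr_ge0 x0; lra.
  have : A * (1 + `|x|) <= `|A| * (1 + `|x|).
    by apply: ler_wpM2r; [lra|exact: ler_norm].
  have := normr_ge0 A; move: (`|A|) Ax => a Ax a0.
  have : a * (1 + `|x|) <= a * (2 * `|x|) by apply: ler_wpM2l => //; lra.
  have : (2 * a) * `|x| <= k * `|x| * `|x| by apply: ler_wpM2r.
  rewrite expr2; nra.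
pose Q := [set z : R * R | - r <= z.1 <= r /\ s <= z.2 <= T].
have QE : Q = `[- r, r]%classic `*` `[s, T]%classic.
  by apply/seteqP; split => -[x t] /=; rewrite !in_itv.
have [x [t [xr stT gmax]]] : exists x t : R,
    [/\ - r <= x <= r, s <= t <= T & forall z, Q z -> g z.1 z.2 <= g x t].
  suff [[x t] /set_mem[xr tT] gmax] :
      exists2 c, c \in Q & forall z, z \in Q -> g z.1 z.2 <= g c.1 c.2.
    by exists x, t; split => // z /mem_set /gmax.
  apply: (@compact_EVT_max _ R (fun z : R * R => g z.1 z.2)).
  - exists (x0, t0); split => //=.
    by rewrite -ler_norml /r; lra.
  - by rewrite QE; apply: compact_setX; exact: segment_compact.
  - apply: (@continuous_subspaceW _ _ _ [set z : R * R | s <= z.2 <= T]).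
      by move=> [x t] /= [].
    suff hc : continuous (fun z : R * R => k * e z.2 * (1 + z.1 ^+ 2)).
      move=> z; have hz : {for z, {within [set z | s <= z.2 <= T],
          continuous (fun z : R * R => k * e z.2 * (1 + z.1 ^+ 2))}}.
        exact: (@continuous_subspaceT _ _ _ _ hc z).
      exact: (cvgB (wc z) hz).
    move=> z.
    have c1 : (fun z : R * R => z.1 * z.1) x @[x --> z] --> z.1 * z.1.
      by apply: cvgM; exact: cvg_fst.
    have c2 : (fun z : R * R => e z.2) x @[x --> z] --> e z.2.
      apply: (@continuous_comp _ _ _ snd e); first exact: cvg_snd.
      apply: (@continuous_comp _ _ _ (fun t => K * (t - s)) expR);
        last exact: continuous_expR.
      apply: cvgM; first exact: cvg_cst.
      by apply: cvgB; [exact: cvg_id|exact: cvg_cst].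
    apply: cvgM; first by apply: cvgM => //; exact: cvg_cst.
    by apply: cvgD; [exact: cvg_cst|exact: c1].
move/andP : (stT) => [st tT].
have {}gmax (y u : R) : - r <= y <= r -> s <= u <= T -> g y u <= g x t.
  by move=> yr uT; exact: (gmax (y, u)).
have gxt : 0 < g x t.
  by apply: lt_le_trans g0 _; apply: gmax => //; rewrite -ler_norml /r; lra.
(* The maximum is not at the initial time, where the hypothesis on [w x s] gives [g <= 0]. *)
have {}st : s < t.
  rewrite lt_neqAle st andbT; apply/negP => /eqP ts; move: gxt.
  by rewrite /g -ts /e subrr mulr0 expR0 mulr1 subr_gt0 ltNge ws.
have {}stT : s < t <= T by rewrite st.
have wxt : 0 < w x t.
  move: gxt; rewrite /g => gxt.
  have : 0 <= k * e t * (1 + x ^+ 2).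
    by apply: mulr_ge0; [apply/ltW/mulr_gt0|rewrite addr_ge0 ?sqr_ge0].
  lra.
have dsq (y : R) :
    is_derive y 1 (fun y : R => k * e t * (1 + y ^+ 2)) (k * e t * (2 * y)).
  have H := is_derive_mul (is_derive_id y 1) (is_derive_id y 1).
  have {}H := is_derive_scale (k * e t) (is_derive_add (is_derive_cst (1 : R) y 1) H).
  by apply: (is_derive_eq H) => /=; ring.
have gx (y : R) : is_derive y 1 (g^~ t) (wx y t - k * e t * (2 * y)).
  exact: is_derive_sub (dx y t stT) (dsq y).
have gxx : is_derive x 1 (fun y => wx y t - k * e t * (2 * y)) (wxx x t - k * e t * 2).
  have H := is_derive_scale (k * e t) (is_derive_scale 2 (is_derive_id x 1)).
  by apply: (is_derive_eq (is_derive_sub (dxx x t stT) H)); rewrite mulr1.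
have gt_ : is_derive t 1 (g x) (wt x t - k * (e t * K) * (1 + x ^+ 2)).
  have de : is_derive t 1 e (e t * K).
    have H : is_derive t 1 (fun y : R => K * (y - s)) K.
      have -> : (fun y => K * (y - s)) = (fun y => K * y + - (K * s)).
        by apply/funext => y; ring.
      exact: is_derive_affine.
    exact: (@is_derive_comp _ expR _ _ _ _ (is_derive_expR _) H).
  have H := is_derive_mul (is_derive_scale k de) (is_derive_cst (1 + x ^+ 2) t 1).
  by apply: (is_derive_eq (is_derive_sub (dt x t stT) H)); rewrite mulr0 addr0.
(* The maximum over the box is one over the whole line, since [g <= 0] outside it. *)
have [|gx0 gxx0] := derive_at_max gx gxx _.
  move=> y; have [yr|yr] := lerP `|y| r.
    by apply: gmax; rewrite -?ler_norml// ltW.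
  by apply: ltW; apply: le_lt_trans gxt; apply: gr => //; rewrite ltW.
have gt0 : 0 <= wt x t - k * (e t * K) * (1 + x ^+ 2).
  apply: (derive_at_left_max gt_ st) => u /andP[su ut].
  by apply: gmax => //; rewrite su (le_trans ut).
have := wE x t stT wxt.
have -> : wx x t = k * e t * (2 * x) by apply/eqP; rewrite -subr_eq0 gx0.
have c0 : 0 < k * e t by rewrite mulr_gt0.
rewrite !normrM (gtr0_norm k0) (gtr0_norm (e0 t)) gtr0_norm// => wE'.
(* With this inequality the right side of the equation is at most [(2 eps + b) k e (1 + x^2)], while
   the barrier contributes [K k e (1 + x^2)]; the extra 1 in [K] makes the contradiction strict. *)
have x2 : 2 * `|x| <= 1 + x ^+ 2.
  by rewrite -subr_ge0 -(real_normK (num_real x)); have := sqr_ge0 (`|x| - 1); nra.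
have {}gxx0 : eps * wxx x t <= eps * (k * e t * 2).
  by apply: ler_wpM2l => //; lra.
have bx : b * (k * e t * (2 * `|x|)) <= b * (k * e t * (1 + x ^+ 2)).
  by apply: ler_wpM2l => //; apply: ler_wpM2l => //; exact: ltW.
have x20 := sqr_ge0 x.
have : eps * (k * e t * 2) <= eps * (k * e t * 2) * (1 + x ^+ 2).
  by rewrite ler_peMr//; [apply: mulr_ge0 => //; lra|lra].
have : 0 < k * e t * (1 + x ^+ 2) by apply: mulr_gt0 => //; lra.
move: gt0; rewrite /K; lra.
Qed.

End maximum_principle.

(** * Primitives and the potential of a closed form *)

Section potential.
Context {R : realType}.
Implicit Types (f : R -> R) (v w F : R -> R -> R).

(** Compactness of [[-r, r]] turns continuity at the points [(y, t0)] into a modulus in time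
    independent of [y]. The domain [D] is general because the estimate serves both at positive times
    and at time 0, on the boundary of the closed half-plane. *)
Lemma uniform_in_time (D : set (R * R)) w (t0 r k : R) :
  continuous_on D w -> (forall y, `|y| <= r -> D (y, t0)) -> 0 < k ->
  exists2 d, 0 < d & forall y t, `|y| <= r -> `|t - t0| < d -> D (y, t) ->
    `|w y t - w y t0| <= k.
Proof.
move=> /subspace_continuousP wc Dr k0.
have /compact_near_coveringP cr := @segment_compact R (- r) r.
have := cr _ (nbhs t0) (fun t y => `|y| <= r -> D (y, t) -> `|w y t - w y t0| <= k) _.
move=> []; last first.
  move=> d /= d0 H; exists d => // y t yr td Dyt.
  apply: (H t) => //; first by rewrite /ball/= distrC.
  by rewrite /= in_itv/= -ler_norml.
move=> y /=; rewrite in_itv/= -ler_norml => yr.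
have /cvgrPdist_le := wc (y, t0) (Dr _ yr).
move=> /(_ _ (divr_gt0 k0 (ltr0n R 2)))/=.
rewrite near_withinE => -[[V W] /= [Vy Wt]] VW.
exists (V, W) => // -[y' t] [/= Vy' Wt'] y'r Dy't.
have h1 := VW (y', t) (conj Vy' Wt') Dy't.
have h2 := VW (y', t0) (conj Vy' (nbhs_singleton Wt)) (Dr _ y'r).
rewrite /= in h1 h2; rewrite distrC -(subrKA (w y t0)).
apply: le_trans (ler_normD _ _) _; rewrite distrC in h2.
by rewrite [leRHS]splitr addrC lerD.
Qed.

Lemma is_derive_epsilon f (t d : R) :
  (forall k, 0 < k -> exists2 e, 0 < e & forall h, `|h| < e ->
     `|f (t + h) - f t - h * d| <= k * `|h|) ->
  is_derive t 1 f d.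
Proof.
move=> fd.
have dl : h^-1 *: (f (h *: 1 + t) - f t) @[h --> 0^'] --> d.
  apply/cvgrPdist_le => k k0; have [e e0 he] := fd k k0.
  rewrite near_withinE; apply/nbhs_ballP; exists e => // h.
  rewrite /ball/= sub0r normrN => hle h0.
  rewrite scaler1 [h + t]addrC; have := he h hle.
  rewrite -(ler_pM2l (_ : 0 < `|h^-1|)) ?normr_gt0 ?invr_eq0//.
  rewrite -normrM mulrCA -normrM mulVf// normr1 mulr1 distrC.
  by congr (`|_| <= _); rewrite mulrBr mulrA mulVf// mul1r.
by apply: DeriveDef; [apply/cvg_ex; exists d|apply/cvg_lim].
Qed.

Local Notation mu := (@lebesgue_measure R).

Lemma half_line_primitive f (a : R) : continuous f ->
  exists P : R -> R, forall x : R, a < x -> is_derive x 1 P (f x).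
Proof.
move=> fc; exists (fun x => \int[mu]_(t in `[a, x]) f t) => x ax.
have x1 : x < x + 1 by rewrite ltrDl.
have fi : mu.-integrable `[a, (x + 1)] (EFin \o f).
  apply: continuous_compact_integrable; first exact: segment_compact.
  exact: continuous_subspaceT.
have [d <-] := continuous_FTC1_closed x1 fi ax (fc x).
by rewrite derive1E; exact/derivableP.
Qed.

Lemma continuous_primitive f : continuous f ->
  exists P : R -> R, forall x : R, is_derive x 1 P (f x).
Proof.
move=> fc; have [P1 dP1] := half_line_primitive (-1) fc.
have fNc : continuous (fun x => f (- x)).
  move=> x; apply: (@continuous_comp _ _ _ -%R f); last exact: fc.
  exact: oppr_continuous.
have [P2 dP2] := half_line_primitive (-1) fNc.
have dP2N (x : R) : x < 1 -> is_derive x 1 (fun y => - P2 (- y)) (f x).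
  move=> x1; have nx1 : -1 < - x by lra.
  have H := is_derive_comp (dP2 _ nx1) (is_derive_opp (is_derive_id x 1)).
  by apply: (is_derive_eq (is_derive_opp H)); rewrite opprK mulrN1 opprK.
(* Both branches are primitives on the overlap, so they differ by a constant there; the added
   constants make them agree at 0 and hence on all of [(-1, 0]]. *)
pose P x := if x < 0 then - P2 (- x) + P2 0 + P1 0 else P1 x.
have PE x : -1 < x -> P x = P1 x.
  rewrite /P; case: ifPn => // x0 x1.
  pose D (x : R) : R := P1 x - - P2 (- x).
  have dD (y : R) : x <= y <= 0 -> is_derive y 1 D (f y - f y).
    move=> /andP[xy y0]; have y1 : -1 < y by lra.
    have y1' : y < 1 by lra.
    exact: is_derive_sub (dP1 y y1) (dP2N y y1').
  have [c _] := mean_value x0 dD.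
  by rewrite subrr mul0r /D oppr0; lra.
exists P => x; have [x0|x0] := ltP x 0.
  apply: (@near_eq_is_derive _ _ _ (fun y => - P2 (- y) + (P2 0 + P1 0))) => //.
    near=> y; rewrite /P ifT ?addrA//.
    by near: y; exact: lt_nbhsl.
  have x1 : x < 1 by lra.
  have H := is_derive_add (dP2N x x1) (is_derive_cst (P2 0 + P1 0) x 1).
  by apply: (is_derive_eq H); rewrite addr0.
apply: (@near_eq_is_derive _ _ _ P1) => //; last by apply: (dP1 x); lra.
by near=> y; rewrite PE//; near: y; apply: lt_nbhsr; lra.
Unshelve. all: by end_near. Qed.

(** The substitution [t = exp s] carries the half-line to the whole line, where a primitive is
    already available. *)
Lemma continuous_primitive_gt0 f : (forall t, 0 < t -> {for t, continuous f}) ->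
  exists P : R -> R, forall t : R, 0 < t -> is_derive t 1 P (f t).
Proof.
move=> fc; pose h s := f (expR s) * expR s.
have hc : continuous h.
  move=> s; apply: cvgM; last exact: continuous_expR.
  apply: (@continuous_comp _ _ _ expR f); first exact: continuous_expR.
  exact/fc/expR_gt0.
have [Q dQ] := continuous_primitive hc.
exists (fun t => Q (ln t)) => t t0.
have H := is_derive_comp (dQ (ln t)) (is_derive1_ln t0).
by apply: (is_derive_eq H); rewrite /h lnK ?posrE// mulfK// gt_eqF.
Qed.

(* The Poincare lemma for the closed form [v dx + F dt] on the half-plane. *)
Lemma potential_exists v F vt :
  continuous_on open_halfplane vt ->
  (forall t, 0 < t -> continuous (v^~ t)) ->
  (forall t, 0 < t -> {for t, continuous (F 0)}) ->
  (forall x t : R, 0 < t -> is_derive t 1 (v x) (vt x t)) ->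
  (forall x t : R, 0 < t -> is_derive x 1 (F^~ t) (vt x t)) ->
  exists U : R -> R -> R, forall x t : R, 0 < t ->
    is_derive t 1 (U x) (F x t) /\ is_derive x 1 (U^~ t) (v x t).
Proof.
move=> vtc vc Fc dv dF.
have /choice[P dP] : forall t, exists P, 0 < t ->
    P 0 = 0 /\ forall x : R, is_derive x 1 P (v x t).
  move=> t; have [t0|t0] := ltP 0 t; last by exists (fun=> 0).
  have [P dP] := continuous_primitive (vc t t0).
  exists (fun x => P x - P 0) => _; split => [|x]; first by rewrite subrr.
  have H := is_derive_sub (dP x) (is_derive_cst (P 0) x 1).
  by apply: (is_derive_eq H); rewrite subr0.
have [c dc] := continuous_primitive_gt0 Fc.
exists (fun x t => P t x + c t) => x t t0; split; last first.
  have H := is_derive_add ((dP t t0).2 x) (is_derive_cst (c t) x 1).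
  by apply: (is_derive_eq H); rewrite addr0.
(* The term [c t] accounts for [F 0 t]. What remains is differentiation under the integral sign: the
   primitive [P t x], which vanishes at [x = 0], has time derivative [F x t - F 0 t]. *)
rewrite -(subrK (F 0 t) (F x t)); apply: is_derive_add (dc t t0).
apply: is_derive_epsilon => k k0.
have x1 : 0 < `|x| + 1 by have := normr_ge0 x; lra.
have [|d d0 vtd] := uniform_in_time vtc
  (_ : forall y, `|y| <= `|x| -> open_halfplane (y, t)) (divr_gt0 k0 x1).
  by move=> y _.
(* The bound by [t] keeps [t + h] positive. *)
exists (Num.min d t) => [|h]; first by rewrite lt_min d0.
rewrite lt_min => /andP[hd ht].
have th0 : 0 < t + h by have := ler_norm (- h); rewrite normrN; lra.
(* The error of the first-order expansion in time, seen as a function of space: it vanishes at 0,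
   and its derivative is the corresponding error for [v]. *)
pose D (y : R) : R := P (t + h) y - P t y - h * (F y t - F 0 t).
have D0 : D 0 = 0 by rewrite /D (dP _ t0).1 (dP _ th0).1; ring.
have dD (y : R) : is_derive y 1 D (v y (t + h) - v y t - h * vt y t).
  have H1 := is_derive_sub ((dP _ th0).2 y) ((dP _ t0).2 y).
  have H2 := is_derive_sub (dF y t t0) (is_derive_cst (F 0 t) y 1).
  have H := is_derive_sub H1 (is_derive_scale h H2).
  by apply: (is_derive_eq H); rewrite subr0.
have -> : P (t + h) x - P t x - h * (F x t - F 0 t) = D x - D 0 by rewrite D0 subr0.
apply: (@le_trans _ _ (k / (`|x| + 1) * `|h| * `|x - 0|)).
  apply: (mean_value_le (fun y _ => dD y)) => y /between_dist_le.
  rewrite !subr0 => yx.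
  (* Subtracting the linear part leaves the time derivative [vt y s - vt y t], which is uniformly
     small for [|y| <= |x|]. *)
  pose E (s : R) : R := v y s - vt y t * s.
  have dE (s : R) : 0 < s -> is_derive s 1 E (vt y s - vt y t).
    move=> s0; have H := is_derive_scale (vt y t) (is_derive_id s 1).
    by apply: (is_derive_eq (is_derive_sub (dv y s s0) H)); rewrite mulr1.
  have -> : v y (t + h) - v y t - h * vt y t = E (t + h) - E t by rewrite /E; ring.
  have -> : `|h| = `|(t + h) - t| by rewrite addrAC subrr add0r.
  have sP s : Num.min t (t + h) <= s <= Num.max t (t + h) -> 0 < s /\ `|s - t| < d.
    move=> /between_dist_le; rewrite addrAC subrr add0r => sh.
    have sd : `|s - t| < d by exact: le_lt_trans hd.
    by split=> //; have := ler_norm (- (s - t)); rewrite normrN; lra.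
  have dE' (s : R) : Num.min t (t + h) <= s <= Num.max t (t + h) ->
    is_derive s 1 E (vt y s - vt y t) by move=> /sP[/dE].
  apply: (mean_value_le dE') => s /sP[s0 st].
  exact: vtd.
rewrite subr0 mulrAC ler_wpM2r// mulrAC ler_pdivrMr//.
by rewrite ler_pM2l//; lra.
Qed.

End potential.

(** * Powers of nonnegative functions, oscillation, and functions on a time strip *)

Section power_and_oscillation.
Context {R : realType}.

Lemma is_derive_epsilon_inv (f : R -> R) (t d k : R) : is_derive t 1 f d -> 0 < k ->
  exists2 e, 0 < e & forall h, `|h| < e ->
    `|f (t + h) - f t - h * d| <= k * `|h|.
Proof.
move=> [df dE] k0.
have dl : h^-1 *: (f (h *: 1 + t) - f t) @[h --> 0^'] --> d by rewrite -dE; exact: df.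
move/cvgrPdist_le : dl => /(_ _ k0).
rewrite near_withinE => /nbhs_ballP[e /= e0 he]; exists e => // h hle.
have [->|h0] := eqVneq h 0; first by rewrite addr0 mul0r !subrr normr0 mulr0.
have := he h; rewrite /ball/= sub0r normrN => /(_ hle h0).
rewrite scaler1 [h + t]addrC distrC => dk.
have -> : f (t + h) - f t - h * d = h * (h^-1 *: (f (t + h) - f t) - d).
  by rewrite mulrBr /GRing.scale/= mulrA mulfV// mul1r.
by rewrite normrM mulrC ler_wpM2r.
Qed.

(** Where [f] is positive this is the chain rule. At a zero of [f] the power itself may fail to have
    a two-sided derivative, but [f] is at most linear in the increment, so [p > 1] makes [f^p] of
    smaller order and its derivative 0. *)
Lemma is_derive_powR_ge0 (f : R -> R) (x d p : R) : 1 < p ->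
  (\forall y \near x, 0 <= f y) ->
  is_derive x 1 f d ->
  is_derive x 1 (fun y => f y `^ p) (p * f x `^ (p - 1) * d).
Proof.
move=> p1 f0 fd; have [fx|fx] := ltP 0 (f x).
  exact: (@is_derive_comp _ (fun y => y `^ p) _ _ _ _ (is_derive1_powR p fx) fd).
have {fx}fx : f x = 0 by apply/eqP; rewrite eq_le fx (nbhs_singleton f0).
have q0 : 0 < p - 1 by lra.
rewrite fx powR0 ?gt_eqF// mulr0 mul0r.
apply: is_derive_epsilon => k k0.
pose c := `|d| + 1.
have c0 : 0 < c by rewrite /c; have := normr_ge0 d; lra.
have [e e0 he] := is_derive_epsilon_inv fd ltr01.
(* For [|h| <= r] the linear bound [c |h|] is at most [(k / c)^(1 / (p - 1))], so that
   [f^(p-1) <= k / c] and [f^p <= k |h|]. *)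
pose r := (k / c) `^ (p - 1)^-1 / c.
have r0 : 0 < r by rewrite divr_gt0// powR_gt0// divr_gt0.
have /nbhs_ballP[e' /= e'0 fe'] := f0.
exists (Num.min e' (Num.min e r)) => [|h]; first by rewrite !lt_min e'0 e0.
rewrite !lt_min => /and3P[he' hle hr].
have {}f0 : 0 <= f (x + h).
  by apply: fe'; rewrite /ball/= opprD addrA subrr sub0r normrN.
have fh : f (x + h) <= c * `|h|.
  have := he h hle; rewrite fx subr0 mul1r => fh.
  have := ler_norm (f (x + h) - h * d); have := ler_norm (h * d).
  by rewrite normrM /c; lra.
rewrite fx powR0 ?gt_eqF//; last lra.
rewrite mulr0 !subr0 ger0_norm ?powR_ge0//.
have -> : f (x + h) `^ p = f (x + h) * f (x + h) `^ (p - 1).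
  by rewrite mulr_powRB1//; lra.
have fk : f (x + h) `^ (p - 1) <= k / c.
  have -> : k / c = ((k / c) `^ (p - 1)^-1) `^ (p - 1).
    by rewrite -powRrM mulVf ?gt_eqF// powRr1// ltW// divr_gt0.
  apply: ge0_ler_powR; rewrite ?nnegrE; [exact: ltW|exact: f0|exact: powR_ge0|].
  by apply: (le_trans fh); rewrite mulrC -ler_pdivlMr// ltW.
apply: (@le_trans _ _ (c * `|h| * (k / c))).
  by apply: ler_pM => //; exact: powR_ge0.
suff -> : c * `|h| * (k / c) = k * `|h| by [].
by field; rewrite gt_eqF.
Qed.

Lemma bounded_oscillation (S : set R) (M : R) : S !=set0 ->
  (forall a b, S a -> S b -> a - b <= M) ->
  exists c, forall a, S a -> c <= a <= c + M.
Proof.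
move=> [a0 Sa0] SM.
have lS : has_lbound S by exists (a0 - M) => b Sb; have := SM _ _ Sa0 Sb; lra.
exists (inf S) => a Sa; apply/andP; split; first exact: ge_inf.
rewrite -lerBlDr; apply: lb_le_inf; first by exists a0.
by move=> b Sb; have := SM _ _ Sa Sb; lra.
Qed.

Lemma ler_of_small_multiples (a M c : R) : 0 < c ->
  (forall k, 0 < k -> a <= M + k * c) -> a <= M.
Proof.
move=> c0 H; apply/ler_addgt0Pr => e e0.
by have := H (e / c) (divr_gt0 e0 c0); rewrite divfK// gt_eqF.
Qed.

(** The bound on [v] makes [U] Lipschitz in space uniformly in time, so continuity in time at a
    fixed [x] suffices for joint continuity. *)
Lemma strip_continuous (U : R -> R -> R) (v Ut : R -> R -> R) (B s T : R) :
  (forall x t, s <= t <= T -> `|v x t| <= B) ->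
  (forall x t : R, s <= t <= T -> is_derive x 1 (U^~ t) (v x t)) ->
  (forall x t : R, s <= t <= T -> is_derive t 1 (U x) (Ut x t)) ->
  {within [set z : R * R | s <= z.2 <= T], continuous (fun z => U z.1 z.2)}.
Proof.
move=> vB dx dt; apply/subspace_continuousP => -[x t] /= stT.
have B0 : 0 <= B by apply: le_trans (vB x t stT); exact: normr_ge0.
apply/cvgrPdist_le => e e0; rewrite near_withinE.
have /cvgrPdist_le/(_ _ (divr_gt0 e0 (ltr0n R 2))) := is_derive_continuous (dt x t stT).
move=> Wt.
have r0 : 0 < e / 2 / (B + 1) by rewrite !divr_gt0//; lra.
exists (ball x (e / 2 / (B + 1)), [set u | `|U x t - U x u| <= e / 2]).
  by split => //=; exact: nbhsx_ballx.
move=> [y u] [/= xy tu] suT.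
rewrite -(subrKA (U x u)); apply: le_trans (ler_normD _ _) _.
rewrite [leRHS]splitr; apply: lerD => //.
apply: (@le_trans _ _ (B * `|x - y|)).
  by apply: (@mean_value_le _ (U^~ u) (v^~ u)) => z _; [exact: dx|exact: vB].
apply: (@le_trans _ _ ((B + 1) * `|x - y|)); first by rewrite ler_wpM2r//; lra.
by rewrite mulrC -ler_pdivlMr ?ltW//; lra.
Qed.

(** This supplies the growth hypothesis of [maximum_principle]: compactness of [[s, T]] bounds [U]
    on the axis [x = 0], and the bound on [v] carries it to other points. *)
Lemma strip_growth (U : R -> R -> R) (v Ut : R -> R -> R) (B s T : R) : s <= T ->
  (forall x t, s <= t <= T -> `|v x t| <= B) ->
  (forall x t : R, s <= t <= T -> is_derive x 1 (U^~ t) (v x t)) ->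
  (forall x t : R, s <= t <= T -> is_derive t 1 (U x) (Ut x t)) ->
  exists A, forall x t, s <= t <= T -> `|U x t| <= A * (1 + `|x|).
Proof.
move=> sT vB dx dt.
have B0 : 0 <= B by apply: le_trans (vB 0 s _); rewrite ?normr_ge0// lexx.
have Uc : {within `[s, T], continuous (fun t => `|U 0 t|)}.
  apply: continuous_in_subspaceT => t; rewrite inE/= in_itv/= => stT.
  apply: cvg_norm; exact: is_derive_continuous (dt 0 t stT).
have [t0 _ Ut0] := EVT_max sT Uc.
exists (`|U 0 t0| + B) => x t stT.
have U0 : `|U 0 t| <= `|U 0 t0| by apply: Ut0; rewrite in_itv.
have : `|U x t - U 0 t| <= B * `|x - 0|.
  by apply: (@mean_value_le _ (U^~ t) (v^~ t)) => z _; [exact: dx|exact: vB].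
have := ler_normD (U x t - U 0 t) (U 0 t); rewrite subrK subr0 => h1 h2.
have := normr_ge0 (U 0 t0); have := normr_ge0 x; nra.
Qed.

End power_and_oscillation.

(** * The potential of a regular solution and its oscillation *)

Section cauchy_problem.
Context {R : realType}.
Variables (p eps : R) (f : R -> R) (v : R -> R -> R).
Hypotheses (p1 : 1 < p) (eps0 : 0 < eps) (vS : cauchy_solution p eps f v).

Let vC := ca_classical vS.

(** The equation reads [v_t = flux_x], so [v dx + flux dt] is closed and [flux] is the time
    derivative of the potential. *)
Definition flux x t := eps * px v x t - v x t `^ p.

Let derivableE (g : R -> R) (x : R) : derivable g x 1 -> is_derive x 1 g (g^`() x).
Proof. by move=> dg; rewrite derive1E; exact/derivableP. Qed.

Lemma cauchy_derive_t (x t : R) : 0 < t -> is_derive t 1 (v x) (pt v x t).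
Proof. by move=> t0; exact/derivableE/(cs_derivable_t vC). Qed.

Lemma cauchy_derive_x (x t : R) : 0 < t -> is_derive x 1 (v^~ t) (px v x t).
Proof. by move=> t0; exact/derivableE/(cs_derivable_x vC). Qed.

Lemma cauchy_derive_xx (x t : R) : 0 < t -> is_derive x 1 ((px v)^~ t) (px (px v) x t).
Proof. by move=> t0; exact/derivableE/(cs_derivable_xx vC). Qed.

Lemma cauchy_derive_power (x t : R) : 0 < t ->
  is_derive x 1 (fun y => v y t `^ p) (p * v x t `^ (p - 1) * px v x t).
Proof.
move=> t0; have v0 : \forall y \near x, 0 <= v y t.
  by near=> y; apply: (ca_ge0 vS); exact: ltW.
exact: is_derive_powR_ge0 p1 v0 (cauchy_derive_x x t0).
Unshelve. all: by end_near. Qed.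

Lemma cauchy_equation x t : 0 < t ->
  pt v x t = eps * px (px v) x t - p * v x t `^ (p - 1) * px v x t.
Proof.
move=> t0; rewrite -(cs_equation vC x t0).
suff -> : px (fun y s => v y s `^ p) x t = p * v x t `^ (p - 1) * px v x t.
  by rewrite addrK.
by rewrite /px derive1E; have [_ ->] := cauchy_derive_power x t0.
Qed.

Lemma cauchy_derive_flux (x t : R) : 0 < t -> is_derive x 1 (flux^~ t) (pt v x t).
Proof.
move=> t0; rewrite cauchy_equation//.
have H := is_derive_scale eps (cauchy_derive_xx x t0).
exact: is_derive_sub H (cauchy_derive_power x t0).
Qed.

Lemma cauchy_bound T : 0 <= T ->
  exists2 B, 0 < B & forall x t, 0 <= t <= T -> 0 <= v x t <= B.
Proof.
move=> T0; have [B vB] := ca_bounded vS T.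
exists (`|B| + 1) => [|x t /[dup] tT /andP[t0 _]].
  by have := normr_ge0 B; lra.
rewrite (ca_ge0 vS)//=; have := vB x t tT; have := ler_norm B; lra.
Qed.

Lemma cauchy_potential : exists U : R -> R -> R, forall x t : R, 0 < t ->
  is_derive t 1 (U x) (flux x t) /\ is_derive x 1 (U^~ t) (v x t).
Proof.
apply: potential_exists (cs_continuous_t vC) _ _
  cauchy_derive_t cauchy_derive_flux => t t0.
  by move=> x; exact: is_derive_continuous (cauchy_derive_x x t0).
have open_pt (w : R -> R -> R) : continuous_on open_halfplane w ->
    {for t, continuous (w 0)}.
  move=> /subspace_continuousP/(_ (0, t) t0) wc.
  apply/cvgrPdist_le => e e0.
  have /cvgrPdist_le/(_ _ e0) := wc; rewrite near_withinE => -[[V W] /= [V0 Wt] VW].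
  near=> u; apply: (VW (0, u)) => /=; last by near: u; exact: lt_nbhsr.
  by split => /=; [exact: nbhs_singleton|near: u].
apply: cvgB.
  by apply: cvgM; [exact: cvg_cst|exact: open_pt (cs_continuous_x vC)].
have v0 : \forall s \near t, 0 <= v 0 s.
  by near=> s; apply: (ca_ge0 vS); apply: ltW; near: s; exact: lt_nbhsr.
exact: is_derive_continuous (is_derive_powR_ge0 p1 v0 (cauchy_derive_t 0 t0)).
Unshelve. all: by end_near. Qed.

(** Comparison propagates the oscillation bound of the initial primitive. The potential is
    controlled only at positive times, so comparison starts at a small time [z]; the resulting
    errors are multiples of [k], which is arbitrary. *)
Lemma cauchy_oscillation (U : R -> R -> R) (P : R -> R) (M : R) :
  (forall x t : R, 0 < t ->
    is_derive t 1 (U x) (flux x t) /\ is_derive x 1 (U^~ t) (v x t)) ->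
  (forall x : R, is_derive x 1 P (f x)) -> (forall x, 0 <= P x <= M) ->
  forall x t y s, 0 < t -> 0 < s -> U x t - U y s <= M.
Proof.
move=> dU dP PM x t y s t0 s0.
pose T := Num.max t s.
have T0 : 0 <= T by rewrite le_max ltW.
have [B B0 vB] := cauchy_bound T0.
pose b := B `^ (p - 1).
have b0 : 0 <= b by exact: powR_ge0.
(* This collects the barriers of the two comparisons, one evaluated at [x] and one at [y], with [T]
   bounding both elapsed times. *)
pose C := expR ((2 * eps + b + 1) * T) * (2 + x ^+ 2 + y ^+ 2).
have C0 : 0 < C.
  by rewrite mulr_gt0 ?expR_gt0//; have := sqr_ge0 x; have := sqr_ge0 y; lra.
apply: (ler_of_small_multiples C0) => k k0.
have r0 : 0 < B / k by rewrite divr_gt0.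
have [|d d0 vd] := uniform_in_time (ca_continuous vS)
  (_ : forall y, `|y| <= B / k -> closed_halfplane (y, 0)) k0.
  by move=> ? _; exact: lexx.
(* At the small time [z] the potential differs from the primitive [P] of the
   initial datum, up to a constant, by at most [k * (1 + x ^+ 2)]. *)
pose z := Num.min (d / 2) (Num.min t s / 2).
have [z0 zd zt zs] : [/\ 0 < z, z < d, z <= t & z <= s].
  have m0 : 0 < Num.min t s by rewrite lt_min t0.
  have h1 : z <= d / 2 by rewrite ge_min lexx.
  have h2 : z <= Num.min t s / 2 by rewrite ge_min lexx orbT.
  have h3 : Num.min t s <= t by rewrite ge_min lexx.
  have h4 : Num.min t s <= s by rewrite ge_min lexx orbT.
  have z0 : 0 < z by rewrite lt_min !divr_gt0.
  by split => //; lra.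
have tT : t <= T by rewrite le_max lexx.
have sT : s <= T by rewrite le_max lexx orbT.
have zT : z <= T by exact: le_trans tT.
have f0B a : 0 <= f a <= B.
  by rewrite -(ca_initial vS); apply: vB; rewrite lexx T0.
pose D a := U a z - P a.
have dD (a : R) : is_derive a 1 D (v a z - f a) := is_derive_sub (dU a z z0).2 (dP a).
have D0 a : `|D a - D 0| <= k * (1 + a ^+ 2).
  have a2 : `|a| ^+ 2 = a ^+ 2 by rewrite real_normK// num_real.
  (* On [|a| <= B / k] the choice of [z] makes the derivative of [D] at most [k]. Farther out, the
     crude bound [B |a|] is already below [k a^2]. *)
  have [ar|ra] := lerP `|a| (B / k).
    apply: (@le_trans _ _ (k * `|a - 0|)).
      apply: (mean_value_le (fun c _ => dD c)) => c /between_dist_le.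
      rewrite !subr0 => ca.
      rewrite -(ca_initial vS); apply: vd.
      - exact: le_trans ar.
      - by rewrite subr0 gtr0_norm.
      - exact: ltW.
    rewrite subr0 ler_pM2l// -a2; have := sqr_ge0 (`|a| - 1); have := normr_ge0 a; nra.
  apply: (@le_trans _ _ (B * `|a - 0|)).
    apply: (mean_value_le (fun c _ => dD c)) => c _.
    have /andP[v0 vB'] : 0 <= v c z <= B by apply: vB; rewrite ltW.
    have /andP[f0 fB] := f0B c.
    by rewrite ler_norml; apply/andP; split; lra.
  rewrite subr0; apply: (@le_trans _ _ (k * `|a| * `|a|)).
    by rewrite ler_wpM2r// mulrC -ler_pdivrMr// ltW.
  by rewrite -mulrA -expr2 a2 ler_pM2l//; lra.
have zT0 a : z <= a <= T -> 0 < a by move=> /andP[za _]; exact: lt_le_trans za.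
have zT0' a : z < a <= T -> 0 < a by move=> /andP[za _]; exact: lt_trans za.
have vB' a c : z <= c <= T -> 0 <= v a c <= B.
  by move=> /[dup] /zT0 c0 /andP[_ cT]; apply: vB; rewrite ltW.
have nvB a c : z <= c <= T -> `|v a c| <= B.
  by move=> /vB'-/(_ a)/andP[v0 ?]; rewrite ger0_norm.
have dx (a c : R) : z <= c <= T -> is_derive a 1 (U^~ c) (v a c).
  by move=> /zT0 c0; exact: (dU a c c0).2.
have dt (a c : R) : z <= c <= T -> is_derive c 1 (U a) (flux a c).
  by move=> /zT0 c0; exact: (dU a c c0).1.
have dxx (a c : R) : z < c <= T -> is_derive a 1 (v^~ c) (px v a c).
  by move=> /zT0'; exact: cauchy_derive_x.
have expC a b' c : z <= a <= T -> b' <= b ->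
    k * expR ((2 * eps + b' + 1) * (a - z)) * (1 + c ^+ 2) <=
    k * expR ((2 * eps + b + 1) * T) * (1 + c ^+ 2).
  move=> /andP[za aT] bb; apply: ler_wpM2r; first by have := sqr_ge0 c; lra.
  rewrite ler_pM2l// ler_expR.
  have e0 : 0 < eps := eps0.
  apply: (@le_trans _ _ ((2 * eps + b + 1) * (a - z))).
    by apply: ler_wpM2r; lra.
  by apply: ler_wpM2l; lra.
(* Upper bound: dropping [- v^p] makes [U] a subsolution of the heat equation, so no drift term
   enters. *)
have U1 : forall a c, z <= c <= T ->
    U a c - (D 0 + M) <= k * expR ((2 * eps + 0 + 1) * (c - z)) * (1 + a ^+ 2).
  have dxw (a c : R) : z <= c <= T ->
      is_derive a 1 (fun a => U a c - (D 0 + M)) (v a c).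
    move=> zc; have H := is_derive_sub (dx a c zc) (is_derive_cst (D 0 + M) a 1).
    by apply: (is_derive_eq H); rewrite subr0.
  have dtw (a c : R) : z <= c <= T ->
      is_derive c 1 (fun c => U a c - (D 0 + M)) (flux a c).
    move=> zc; have H := is_derive_sub (dt a c zc) (is_derive_cst (D 0 + M) c 1).
    by apply: (is_derive_eq H); rewrite subr0.
  have [A UA] := strip_growth zT nvB dxw dtw.
  apply: (@maximum_principle _ (fun a c => U a c - (D 0 + M)) flux v (px v) _ _ A).
  - exact: ltW.
  - exact: lexx.
  - exact: k0.
  - exact: strip_continuous nvB dxw dtw.
  - by move=> a' c' zc; apply: le_trans (UA a' c' zc); exact: ler_norm.
  - move=> a'; have := ler_norm (D a' - D 0); have := D0 a'; have /andP[_] := PM a'.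
    rewrite {2 3}/D; lra.
  - by move=> a' c' /andP[/ltW zc cT]; apply: dtw; rewrite zc.
  - by move=> a' c' /andP[/ltW zc cT]; apply: dxw; rewrite zc.
  - by move=> a' c' _ _; rewrite mul0r addr0 /flux gerBl powR_ge0.
(* Lower bound: [v^p <= B^(p-1) v], and [v] is the space derivative of [U], so the nonlinearity is
   absorbed as a drift with coefficient [b]. *)
have U2 : forall a c, z <= c <= T ->
    D 0 - U a c <= k * expR ((2 * eps + b + 1) * (c - z)) * (1 + a ^+ 2).
  have dxw (a c : R) : z <= c <= T -> is_derive a 1 (fun a => D 0 - U a c) (- v a c).
    move=> zc; have H := is_derive_sub (is_derive_cst (D 0) a 1) (dx a c zc).
    by apply: (is_derive_eq H); rewrite sub0r.
  have dtw (a c : R) : z <= c <= T -> is_derive c 1 (fun c => D 0 - U a c) (- flux a c).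
    move=> zc; have H := is_derive_sub (is_derive_cst (D 0) c 1) (dt a c zc).
    by apply: (is_derive_eq H); rewrite sub0r.
  have nvB' a' c' : z <= c' <= T -> `|- v a' c'| <= B by rewrite normrN; exact: nvB.
  have [A UA] := strip_growth zT nvB' dxw dtw.
  apply: (@maximum_principle _ (fun a c => D 0 - U a c) (fun a c => - flux a c)
    (fun a c => - v a c) (fun a c => - px v a c) _ _ A).
  - exact: ltW.
  - exact: b0.
  - exact: k0.
  - exact: strip_continuous nvB' dxw dtw.
  - by move=> a' c' zc; apply: le_trans (UA a' c' zc); exact: ler_norm.
  - move=> a'; have := ler_norm (- (D a' - D 0)); have := D0 a'.
    have /andP[+ _] := PM a'.
    rewrite normrN {2 3}/D; lra.
  - by move=> a' c' /andP[/ltW zc cT]; apply: dtw; rewrite zc.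
  - by move=> a' c' /andP[/ltW zc cT]; apply: dxw; rewrite zc.
  - by move=> a' c' zc; exact: is_derive_opp (dxx a' c' zc).
  - move=> a' c' /andP[/ltW zc cT] _.
    have /andP[v0 vB1] : 0 <= v a' c' <= B by apply: vB'; rewrite zc.
    rewrite /flux normrN ger0_norm// mulrN opprB [leRHS]addrC lerD2r.
    rewrite -mulr_powRB1 ?(lt_trans ltr01)// mulrC; apply: ler_wpM2r => //.
    apply: ge0_ler_powR; rewrite ?nnegrE ?(ltW B0)//.
    by rewrite subr_ge0 ltW.
have := le_trans (U1 x t _) (expC t 0 x _ b0).
have := le_trans (U2 y s _) (expC s b y _ (lexx b)).
rewrite zt zs tT sT => /(_ isT isT) h1 /(_ isT isT) h2.
rewrite /C; lra.
Qed.

End cauchy_problem.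

(** * Decay of regular solutions by comparison with the potential *)

Section decay.
Context {R : realType}.
Variables (p eps : R) (f : R -> R) (v : R -> R -> R).
Hypotheses (p1 : 1 < p) (eps0 : 0 < eps) (vS : cauchy_solution p eps f v).

Lemma cauchy_decay (U : R -> R -> R) (c m : R) : 0 < m ->
  (forall x t : R, 0 < t ->
    is_derive t 1 (U x) (flux p eps v x t) /\ is_derive x 1 (U^~ t) (v x t)) ->
  (forall x t, 0 < t -> c <= U x t <= c + m) ->
  forall x t, 0 < t -> v x t `^ p * (p * (p - 1) * t) <= 2 `^ p * m.
Proof.
move=> m0 dU Ucm x T T0.
have q0 : 0 < p - 1 by rewrite subr_gt0.
have p0 : 0 < p by exact: lt_trans p1.
have pp : 0 <= p * (p - 1) by apply/ltW/mulr_gt0.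
have [B B0 vB] := cauchy_bound vS (ltW T0).
(* Comparison starts at a positive time [s], where the potential and its derivatives are available;
   [s] then tends to 0. *)
suff H s : 0 < s -> s < T -> v x T `^ p * (p * (p - 1) * (T - s)) <= 2 `^ p * m.
  apply: (@ler_of_small_multiples _ _ _ (v x T `^ p * (p * (p - 1)) + 1)).
    by rewrite ltr_pwDr// mulr_ge0 ?powR_ge0.
  move=> k k0; pose s := Num.min k (T / 2).
  have sk : s <= k by rewrite ge_min lexx.
  have sT : s <= T / 2 by rewrite ge_min lexx orbT.
  have s0 : 0 < s by rewrite lt_min k0 divr_gt0.
  have := H s s0 _; have -> : s < T by lra.
  move=> /(_ isT).
  have : 0 <= v x T `^ p * (p * (p - 1)) by rewrite mulr_ge0 ?powR_ge0.
  move: (v x T `^ p) => V Vp h.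
  have : V * (p * (p - 1)) * s <= V * (p * (p - 1)) * k by apply: ler_wpM2l.
  lra.
move=> s0 sT.
(* [g] solves [g' = - (p - 1) m^(p-1) g^(p+1)]; its initial value [B / m] makes
   [g s * (m + V)] dominate the bound [B] of [v]. *)
pose a := p * (p - 1) * m `^ (p - 1).
have a0 : 0 < a by rewrite !mulr_gt0// powR_gt0.
pose B1 := (m / B) `^ p.
have B10 : 0 < B1 by rewrite powR_gt0// divr_gt0.
pose h t := B1 + a * (t - s).
have h0 t : s <= t -> 0 < h t.
  by move=> st; rewrite ltr_pwDl// mulr_ge0 ?subr_ge0// ltW.
pose g t := h t `^ (- p^-1).
have g0 t : s <= t -> 0 < g t by move=> st; rewrite powR_gt0 ?h0.
have gp t : s <= t -> g t `^ p = (h t)^-1.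
  by move=> st; rewrite -powRrM mulNr mulVf ?gt_eqF// powR_inv1// ltW ?h0.
have dg (t : R) : s <= t -> is_derive t 1 g (- ((p - 1) * m `^ (p - 1) * g t / h t)).
  move=> st; have dh : is_derive t 1 h a.
    have -> : h = (fun t => a * t + (B1 - a * s)).
      by apply/funext => u; rewrite /h; ring.
    exact: is_derive_affine.
  have H := @is_derive_comp _ (fun y => y `^ (- p^-1)) h _ _ _
    (is_derive1_powR _ (h0 t st)) dh.
  have hB : h t `^ (- p^-1 - 1) = g t / h t.
    rewrite powRB; first by rewrite powRr1// ltW// h0.
    by rewrite (gt_eqF (h0 t st)) implybT.
  apply: (is_derive_eq H); rewrite hB.
  rewrite -/(g t) /a; field.
  by rewrite !gt_eqF ?h0.
have sT0 t : s <= t <= T -> 0 < t by move=> /andP[st _]; exact: lt_le_trans st.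
have vB' y t : s <= t <= T -> 0 <= v y t <= B.
  by move=> /[dup] /sT0 t0 /andP[_ tT]; apply: vB; rewrite ltW.
pose V y t := U y t - c.
have V0 y t : s <= t <= T -> 0 <= V y t <= m.
  by move=> /sT0 t0; have := Ucm y t t0; rewrite /V; lra.
pose w y t := v y t - g t * (m + V y t).
have dVx (y t : R) : 0 < t -> is_derive y 1 (fun y => m + V y t) (v y t).
  move=> t0.
  have H := is_derive_sub (dU y t t0).2 (is_derive_cst c y 1).
  have {}H := is_derive_add (is_derive_cst m y 1) H.
  by apply: (is_derive_eq H); rewrite add0r subr0.
have dVt (y t : R) : 0 < t -> is_derive t 1 (fun t => m + V y t) (flux p eps v y t).
  move=> t0.
  have H := is_derive_sub (dU y t t0).1 (is_derive_cst c t 1).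
  have {}H := is_derive_add (is_derive_cst m t 1) H.
  by apply: (is_derive_eq H); rewrite add0r subr0.
have dwx (y t : R) : 0 < t -> is_derive y 1 (w^~ t) (px v y t - g t * v y t).
  move=> t0; have H := is_derive_scale (g t) (dVx y t t0).
  exact: is_derive_sub (cauchy_derive_x vS y t0) H.
have dwxx (y t : R) : 0 < t ->
    is_derive y 1 (fun y => px v y t - g t * v y t) (px (px v) y t - g t * px v y t).
  move=> t0; have H := is_derive_scale (g t) (cauchy_derive_x vS y t0).
  exact: is_derive_sub (cauchy_derive_xx vS y t0) H.
pose wt y t := pt v y t -
  (- ((p - 1) * m `^ (p - 1) * g t / h t) * (m + V y t) + g t * flux p eps v y t).
have dwt (y t : R) : s <= t -> is_derive t 1 (w y) (wt y t).
  move=> st; have t0 : 0 < t by exact: lt_le_trans st.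
  exact: is_derive_sub (cauchy_derive_t vS y t0) (is_derive_mul (dg t st) (dVt y t t0)).
(* This bounds the drift coefficient [p v^(p-1)]. *)
pose b := p * B `^ (p - 1).
have b0 : 0 <= b by rewrite mulr_ge0 ?powR_ge0// ltW.
have wc : {within [set z : R * R | s <= z.2 <= T], continuous (fun z => w z.1 z.2)}.
  have vc : {within [set z : R * R | s <= z.2 <= T], continuous (fun z => v z.1 z.2)}.
    apply: continuous_subspaceW (cs_continuous (ca_classical vS)) => z.
    exact: sT0.
  have Vc : {within [set z : R * R | s <= z.2 <= T],
      continuous (fun z => m + V z.1 z.2)}.
    apply: (@strip_continuous _ (fun y t => m + V y t) v (flux p eps v) B).
    - by move=> y t /vB'-/(_ y)/andP[vy0 vyB]; rewrite ger0_norm.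
    - by move=> y t /sT0; exact: dVx.
    - by move=> y t /sT0; exact: dVt.
  apply/subspace_continuousP => z zsT.
  have sz : s <= z.2 by case/andP: zsT.
  apply: cvgB; first by move/subspace_continuousP : vc; exact.
  apply: cvgM; last by move/subspace_continuousP : Vc; exact.
  apply: cvg_within_filter.
  apply: (@continuous_comp _ _ _ snd g); first exact: cvg_snd.
  exact: is_derive_continuous (dg z.2 sz).
have wT k : 0 < k ->
    w x T <= k * expR ((2 * eps + b + 1) * (T - s)) * (1 + x ^+ 2).
  move=> k0; apply: (@maximum_principle _ w wt (fun y t => px v y t - g t * v y t)
    (fun y t => px (px v) y t - g t * px v y t) eps b B k s T).
  - exact: ltW.
  - exact: b0.
  - exact: k0.
  - exact: wc.
  - move=> y t st; have /andP[_ vyB] := vB' y t st; have /andP[Vy _] := V0 y t st.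
    have gt := g0 t _; case/andP: st => /gt {}gt _.
    have : 0 <= g t * (m + V y t) by rewrite mulr_ge0 ?ltW//; lra.
    have : B <= B * (1 + `|y|) by rewrite ler_peMr ?lerDl// ltW.
    by rewrite /w; lra.
  - move=> y; have /andP[_ vyB] : 0 <= v y s <= B by apply: vB'; rewrite lexx ltW.
    have /andP[Vy _] : 0 <= V y s <= m by apply: V0; rewrite lexx ltW.
    have gs : g s = B / m.
      rewrite /g /h subrr mulr0 addr0 -powRrM mulrN mulfV ?gt_eqF//.
      by rewrite powR_inv1 ?invf_div// ltW// divr_gt0.
    have : B <= g s * (m + V y s).
      by rewrite gs mulrAC ler_pdivlMr// ler_pM2l// lerDl.
    have : 0 <= k * (1 + y ^+ 2).
      by rewrite mulr_ge0 ?ltW//; have := sqr_ge0 y; lra.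
    by rewrite /w; lra.
  - by move=> y t /andP[/ltW st _]; exact: dwt.
  - by move=> y t /andP[/ltW st _]; apply: dwx; exact: lt_le_trans st.
  - by move=> y t /andP[/ltW st _]; apply: dwxx; exact: lt_le_trans st.
  - move=> y t /andP[/ltW st tT] wyt.
    have t0 : 0 < t by exact: lt_le_trans st.
    have stT : s <= t <= T by rewrite st.
    have /andP[v0 vyB] := vB' y t stT; have /andP[Vy _] := V0 y t stT.
    have gt := g0 t st; have ht := h0 t st.
    have mV : 0 < m + V y t by lra.
    (* Where [w > 0], [v] exceeds [g (m + V)]. Taking p-th powers, [g^p = 1 / h] and [m + V >= m]
       give the claim; the shift of the potential by [m] provides this last lower bound. *)
    have key : m `^ (p - 1) * (m + V y t) / h t <= v y t `^ p.
      apply: (@le_trans _ _ ((g t * (m + V y t)) `^ p)).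
        have mVp : (m + V y t) `^ p = (m + V y t) * (m + V y t) `^ (p - 1).
          by rewrite mulr_powRB1// ltW.
        rewrite (powRM _ (ltW gt) (ltW mV)) (gp t st) mVp.
        rewrite [leRHS]mulrC ler_pM2r ?invr_gt0//.
        rewrite mulrC ler_pM2l//.
        apply: ge0_ler_powR; rewrite ?nnegrE; [exact: ltW|exact: ltW|exact: ltW|].
        by lra.
      apply: ge0_ler_powR; rewrite ?nnegrE; [exact: ltW| |by []|].
        by rewrite mulr_ge0// ltW.
      by move: wyt; rewrite /w; lra.
    have drift : - (p * v y t `^ (p - 1)) * (px v y t - g t * v y t) <=
        b * `|px v y t - g t * v y t|.
      apply: le_trans (ler_norm _) _; rewrite normrM normrN ler_wpM2r//.
      rewrite ger0_norm; last by rewrite mulr_ge0 ?powR_ge0// ltW.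
      rewrite ler_pM2l//; apply: ge0_ler_powR; rewrite ?nnegrE ?(ltW B0)//.
      exact: ltW.
    have vp : v y t * v y t `^ (p - 1) = v y t `^ p by rewrite mulr_powRB1.
    have {}key : (p - 1) * g t * (m `^ (p - 1) * (m + V y t) / h t) <=
        (p - 1) * g t * v y t `^ p by rewrite ler_pM2l// mulr_gt0.
    apply: le_trans (lerD (lexx _) drift).
    (* The equations for [v] and [U] combine into a linear operator applied to [w] plus a
       zeroth-order difference, which [key] makes nonpositive. *)
    have -> : wt y t = eps * (px (px v) y t - g t * px v y t)
        - p * v y t `^ (p - 1) * (px v y t - g t * v y t)
        + ((p - 1) * g t * (m `^ (p - 1) * (m + V y t) / h t)
           - (p - 1) * g t * v y t `^ p).
      by rewrite /wt /flux (cauchy_equation p1 vS)// -vp; field; rewrite gt_eqF.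
    by lra.
  - by rewrite lexx andbT ltW.
have wT0 : w x T <= 0.
  apply: (@ler_of_small_multiples _ _ _
     (expR ((2 * eps + b + 1) * (T - s)) * (1 + x ^+ 2))).
    by rewrite mulr_gt0 ?expR_gt0//; have := sqr_ge0 x; lra.
  by move=> k' /wT; rewrite add0r mulrA.
have sT' : s <= T <= T by rewrite ltW//=.
have /andP[_ Vm] := V0 x T sT'.
have vle : v x T <= g T * (2 * m).
  move: wT0; rewrite /w subr_le0 => /le_trans; apply.
  by rewrite (ler_pM2l (g0 T (ltW sT))); lra.
have {}vle : v x T `^ p <= (h T)^-1 * (2 `^ p * (m * m `^ (p - 1))).
  rewrite (mulr_powRB1 (ltW m0) p0).
  rewrite -(powRM _ (ler0n _ 2) (ltW m0)) -(gp T (ltW sT)).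
  rewrite -(powRM _ (ltW (g0 T (ltW sT))) (mulr_ge0 (ler0n _ 2) (ltW m0))).
  apply: ge0_ler_powR; rewrite ?nnegrE; [exact: ltW| | |exact: vle].
    by have /andP[] := vB' x T sT'.
  by apply: mulr_ge0; [exact/ltW/g0/ltW|exact: mulr_ge0 (ler0n _ 2) (ltW m0)].
have mp : 0 < m `^ (p - 1) by exact: powR_gt0.
have hT := h0 T (ltW sT).
rewrite -(ler_pM2r mp); move: vle; rewrite mulrC ler_pdivlMr// => vle.
apply: le_trans (_ : v x T `^ p * h T <= _); last by move: vle; lra.
have -> : v x T `^ p * (p * (p - 1) * (T - s)) * m `^ (p - 1) =
    v x T `^ p * (a * (T - s)) by rewrite /a; ring.
apply: ler_wpM2l; first exact: powR_ge0.
(* Discarding [B1] from [h T] frees the estimate of the sup bound [B]. *)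
by rewrite /h lerDr ltW.
Qed.

End decay.

(** * Bounds in terms of the mass, and interpolation *)

Section norms.
Context {R : realType}.
Local Notation mu := (@lebesgue_measure R).

(** Increments of a primitive are integrals of [f >= 0] over intervals, hence at most its total
    integral; subtracting the infimum normalises the range. *)
Lemma bounded_primitive (f : R -> R) (M : R) : continuous f -> (forall x, 0 <= f x) ->
  ('N[mu]_1[EFin \o f] <= M%:E)%E ->
  exists P : R -> R, (forall x : R, is_derive x 1 P (f x)) /\ forall x, 0 <= P x <= M.
Proof.
move=> fc f0 fM; have [P dP] := continuous_primitive fc.
have M0 : 0 <= M by rewrite -lee_fin; apply: le_trans fM; exact: Lnorm_ge0.
have PM a b : P b - P a <= M.
  have [ba|ab] := leP b a.
    apply: le_trans M0; rewrite subr_le0.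
    move: ba; rewrite le_eqVlt => /predU1P[->//|ba].
    have [c _] := mean_value ba (fun x _ => dP x).
    by rewrite -subr_ge0 => ->; rewrite mulr_ge0 ?f0// subr_ge0 ltW.
  have fab : {within `[a, b], continuous f} by exact: continuous_subspaceT.
  have Pab : derivable_oo_LRcontinuous P a b.
    split; first by move=> x _; have [] := dP x.
      by apply: cvg_at_right_filter; exact: is_derive_continuous (dP a).
    by apply: cvg_at_left_filter; exact: is_derive_continuous (dP b).
  have PE : {in `]a, b[%R, P^`() =1 f}.
    by move=> x _; rewrite derive1E; have [_ ->] := dP x.
  rewrite -lee_fin EFinB -(continuous_FTC2 ab fab Pab PE); apply: le_trans fM.
  rewrite Lnorm1.
  have mf : measurable_fun setT f by exact: continuous_measurable_fun.
  apply: (@le_trans _ _ (\int[mu]_x (f x)%:E)%E).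
    apply: ge0_subset_integral => //; first exact/measurable_EFinP.
    by move=> x _; rewrite lee_fin.
  apply: ge0_le_integral => //.
  - by move=> x _; rewrite lee_fin.
  - exact/measurable_EFinP.
  - by apply: measurableT_comp => //; exact/measurable_EFinP.
  - by move=> x _ /=; rewrite lee_fin ler_norm.
have [||c cP] := @bounded_oscillation _ (range P) M.
- by exists (P 0); exists 0.
- by move=> _ _ [a _ <-] [b _ <-]; exact: PM.
exists (fun x => P x - c); split => [x|x].
  have H := is_derive_sub (dP x) (is_derive_cst c x 1).
  by apply: (is_derive_eq H); rewrite subr0.
by have := cP (P x) (imageT P x); lra.
Qed.

Lemma cauchy_sup_decay (p eps M : R) (f : R -> R) (v : R -> R -> R) :
  1 < p -> 0 < eps -> cauchy_solution p eps f v -> continuous f ->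
  (forall x, 0 <= f x) -> ('N[mu]_1[EFin \o f] <= M%:E)%E ->
  forall x t, 0 < t ->
    v x t <= 2 * (p * (p - 1)) `^ (- p^-1) * M `^ p^-1 * t `^ (- p^-1).
Proof.
move=> p1 eps0 vS fc f0 fM x t t0.
have p0 : 0 < p by exact: lt_trans p1.
have q0 : 0 < p - 1 by rewrite subr_gt0.
have pp : 0 < p * (p - 1) by exact: mulr_gt0.
have M0 : 0 <= M by rewrite -lee_fin; apply: le_trans fM; exact: Lnorm_ge0.
have [P [dP PM]] := bounded_primitive fc f0 fM.
have [U dU] := cauchy_potential p1 vS.
have osc := cauchy_oscillation p1 eps0 vS dU dP PM.
have [||c cU] := @bounded_oscillation _ [set a | exists x t, 0 < t /\ a = U x t] M.
- by exists (U 0 1); exists 0, 1; split.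
- by move=> _ _ [y [s [s0 ->]]] [z [u [u0 ->]]]; exact: osc.
have {}cU y s : 0 < s -> c <= U y s <= c + M by move=> s0; apply: cU; exists y, s.
have H : v x t `^ p * (p * (p - 1) * t) <= 2 `^ p * M.
  (* The decay estimate asks for a positive length, whereas [M] may be 0; it is applied with [M + k]
     for arbitrary [k > 0]. *)
  apply: (@ler_of_small_multiples _ _ _ (2 `^ p)); first exact: powR_gt0.
  move=> k k0; have Mk : 0 < M + k by lra.
  rewrite (mulrC k) -mulrDr.
  apply: (@cauchy_decay R p eps f v p1 eps0 vS U c _ Mk dU) => // y s s0.
  by have := cU y s s0; lra.
have v0 : 0 <= v x t by apply: (ca_ge0 vS); exact: ltW.
have {}H : v x t `^ p <= 2 `^ p * M / (p * (p - 1) * t).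
  by rewrite ler_pdivlMr// mulr_gt0.
have -> : v x t = (v x t `^ p) `^ p^-1.
  by rewrite -powRrM mulfV ?gt_eqF// powRr1.
apply: (@le_trans _ _ ((2 `^ p * M / (p * (p - 1) * t)) `^ p^-1)).
  apply: ge0_ler_powR; rewrite ?nnegrE ?powR_ge0 ?invr_ge0//; first exact: ltW.
  by rewrite mulr_ge0 ?invr_ge0 ?mulr_ge0 ?powR_ge0// ltW.
have p2 : 0 <= 2 `^ p :> R by exact: powR_ge0.
rewrite (powRM _ (mulr_ge0 p2 M0)); last by rewrite invr_ge0 ltW// mulr_gt0.
rewrite (powRM _ p2 M0) -powRrM mulfV ?gt_eqF// powRr1//.
have X0 : 0 <= p * (p - 1) * t by rewrite ltW// mulr_gt0.
rewrite -(powR_inv1 X0) -(powRrM _ (-1)) mulN1r (powRM _ (ltW pp) (ltW t0)).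
suff -> : 2 * M `^ p^-1 * ((p * (p - 1)) `^ (- p^-1) * t `^ (- p^-1)) =
  2 * (p * (p - 1)) `^ (- p^-1) * M `^ p^-1 * t `^ (- p^-1) by [].
by ring.
Qed.

Lemma cvg_locally_uniformly_pt (v : nat -> R -> R -> R) (u : R -> R -> R) (x t : R) :
  cvg_locally_uniformly v u -> 0 < t -> v k x t @[k --> \oo] --> u x t.
Proof.
move=> vu t0; have := vu [set (x, t)] (@compact_set1 _ (x, t)).
have xt : [set (x, t)] `<=` @open_halfplane R by move=> _ ->.
by move=> /(_ xt); rewrite uniform_set1.
Qed.

(** The pointwise bound [g^2 <= L g] integrates to [L M]. *)
Lemma Lnorm2_interpolation (g : R -> R) (L M : R) : measurable_fun setT g ->
  (forall x, 0 <= g x <= L) -> (\int[mu]_x (g x)%:E = M%:E)%E ->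
  ('N[mu]_2%:E[EFin \o g] <= ((L * M) `^ 2^-1)%:E)%E.
Proof.
move=> mg gL gM; have L0 : 0 <= L by have /andP[g0 +] := gL 0; exact: le_trans.
rewrite unlock -poweR_EFin; apply: gt0_ler_poweR; rewrite ?invr_ge0//.
- by rewrite in_itv/= leey andbT; apply: integral_ge0 => x _; rewrite lee_fin powR_ge0.
- rewrite in_itv/= leey andbT lee_fin mulr_ge0// -lee_fin -gM.
  by apply: integral_ge0 => x _; rewrite lee_fin; have /andP[] := gL x.
rewrite EFinM -gM -ge0_integralZl//; last first.
- by move=> x _; rewrite lee_fin; have /andP[] := gL x.
- exact/measurable_EFinP.
apply: ge0_le_integral => //.
- by move=> x _; exact: poweR_ge0.
- apply: (measurableT_comp (measurable_poweR _)).
  by apply: measurableT_comp => //; exact/measurable_EFinP.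
- by apply/measurable_EFinP; exact: measurable_funM.
- move=> x _ /=; have /andP[g0 gLx] := gL x.
  by rewrite lee_fin ger0_norm// powR_mulrn// expr2 ler_wpM2r.
Qed.

End norms.

(** * Decay of the solution with measure data *)

Lemma Lnorm_pinfty_le (R : realType) (g : R -> R) (L : R) : (forall x, 0 <= g x <= L) ->
  ('N[@lebesgue_measure R]_+oo[EFin \o g] <= L%:E)%E.
Proof.
move=> gL; have L0 : 0 <= L by have /andP[g0 +] := gL 0; exact: le_trans.
rewrite unlock; case: ifPn => _; last by rewrite lee_fin.
apply/ess_supP; apply: nearW => x /=; have /andP[g0 gLx] := gL x.
by rewrite ger0_norm// lee_fin.
Qed.

Theorem theorem6p1 (R : realType) (p : R) (hp : 1 < p)
    (u0 : {finite_measure set (measurableTypeR R) -> \bar R})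
    (hu0 : compactly_supported_measure u0) :
  exists C : R, 0 < C /\
    forall eps : R, 0 < eps ->
    forall u : R -> R -> R, measure_data_solution p eps u0 u ->
      (forall t : R, 0 < t ->
        ('N[@lebesgue_measure R]_+oo[EFin \o u^~ t]
         <= (C * fine (u0 setT) `^ p^-1 * t `^ (- p^-1))%:E)%E) /\
      (forall t : R, 0 < t ->
        ('N[@lebesgue_measure R]_2%:E[EFin \o u^~ t]
         <= (C * fine (u0 setT) `^ ((p + 1) / (2 * p))
               * t `^ (- (2 * p)^-1))%:E)%E).
Proof.
have p0 : 0 < p by exact: lt_trans hp.
have q0 : 0 < p - 1 by rewrite subr_gt0.
pose C := 2 * (p * (p - 1)) `^ (- p^-1).
have C0 : 0 < C by rewrite mulr_gt0// powR_gt0// mulr_gt0.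
pose M := fine (u0 setT).
have u0M : u0 setT = M%:E by rewrite fineK// fin_num_measure.
have M0 : 0 <= M by rewrite fine_ge0.
have C2 : 0 < C `^ 2^-1 by exact: powR_gt0.
(* The sup bound holds with [C] and the L^2 bound with the square root of [C]; the sum serves both
   and depends on [p] alone. *)
exists (C + C `^ 2^-1); split; first exact: addr_gt0.
move=> eps eps0 u uS.
have decay (x t : R) : 0 < t -> 0 <= u x t <= C * M `^ p^-1 * t `^ (- p^-1).
  move=> t0; rewrite (ms_ge0 uS)//=.
  have [f [v [s [fS vS sS [vu _ _ _]]]]] := ms_limit uS.
  have vxt := @cvg_locally_uniformly_pt R _ u x t vu t0.
  rewrite -(cvg_lim (@Rhausdorff R) vxt); apply: limr_le.
    by apply/cvg_ex; exists (u x t).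
  (* Every approximation obeys the bound with the same constants, because its initial mass is at
     most that of [u0], so the pointwise limit inherits it. *)
  apply: nearW => k; apply: cauchy_sup_decay hp eps0 (vS (s k)) _ _ _ _ _ t0.
  - move=> y; have /derivableP := @rd_smooth _ _ _ fS (s k) 0%N y.
    exact: is_derive_continuous.
  - exact: rd_ge0 fS (s k).
  - by rewrite -u0M; exact: rd_mass fS (s k).
have L0 t : 0 <= M `^ p^-1 * t `^ (- p^-1) by rewrite mulr_ge0 ?powR_ge0.
split=> t t0.
  apply: (le_trans (Lnorm_pinfty_le (fun x => decay x t t0))).
  rewrite lee_fin -/M -(mulrA C) -(mulrA (C + _)); apply: ler_wpM2r; first exact: L0.
  by rewrite lerDl ltW.
have mu_ : measurable_fun setT (u^~ t).
  apply: continuous_measurable_fun => x.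
  apply: is_derive_continuous; apply/derivableP.
  exact: cs_derivable_x (ms_classical uS) x t t0.
have uM : (\int[@lebesgue_measure R]_x (u x t)%:E = M%:E)%E.
  by rewrite (ms_mass uS)// u0M.
apply: (le_trans (Lnorm2_interpolation mu_ (fun x => decay x t t0) uM)).
rewrite lee_fin -/M.
have -> : (p + 1) / (2 * p) = (p^-1 + 1) * 2^-1 by field; rewrite gt_eqF.
have -> : - (2 * p)^-1 = - p^-1 * 2^-1 by field; rewrite gt_eqF.
have MM : M `^ p^-1 * M = M `^ (p^-1 + 1).
  rewrite powRD ?powRr1//; apply/implyP; rewrite gt_eqF//.
  by rewrite addr_gt0// invr_gt0.
have -> : C * M `^ p^-1 * t `^ (- p^-1) * M = C * (M `^ (p^-1 + 1) * t `^ (- p^-1)).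
  by rewrite -MM; ring.
rewrite (powRM _ (ltW C0)) ?mulr_ge0 ?powR_ge0// powRM ?powR_ge0//.
rewrite -!powRrM -(mulrA (C + _)); apply: ler_wpM2r.
  by rewrite mulr_ge0 ?powR_ge0.
by rewrite lerDr ltW.
Qed.
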